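(* Let $f:\mathbb R^n\to\mathbb R^n$ be a polynomial vector field with $p:=\deg(f)\ge 2$ and $f(0)=0$, and let $h:=p-1$. Let $x_0\in\mathbb R^n$, let $T>0$ be such that $[0,T]$ is contained in the interval of definition of the solution $x(t;x_0)$ of $\dot x=f(x)$, $x(0)=x_0$, and let $R<+\infty$ satisfy $\sup_{t\in[0,T]}\|x(t;x_0)\|_\infty\le R$; put $R_+:=\max(R,1)$. For each $D\ge1$ let $v$ be the coefficient vector (supported on degree $1$) of the observable $g=v^T\alpha$ and let $\epsilon_D(t;x_0)$ be the error of the degree-$D$ truncated Carleman linearization, as defined in the context. Then for every $D\ge 1$ and every $t\in[0,T]$, $$\epsilon_D(t;x_0)\le \|v\|_1\,D\,C_2\,R^{D+1}R_+^{h-1}\sum_{j=k_D}^{D-1}P_j\,C_2^j\,\frac{\Theta(t)^{j+1}}{(j+1)!}.$$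
   Context: Here $\deg(f)=\max_k\deg(f_k)$ (total degree). Write $f(x)=F_1x+f_{\ge2}(x)$, where $F_1=Df(0)$ is the Jacobian of $f$ at $0$ and $(f_{\ge2})_i(x)=\sum_{2\le|\gamma|\le p}c_{i\gamma}x^\gamma$ ($\gamma\in\mathbb N^n$, $|\gamma|=\sum_i\gamma_i$). Set $C_2:=\max_{1\le i\le n}\sum_{2\le|\gamma|\le p}|c_{i\gamma}|$. For a $k\times k$ real matrix $U$, $\mu_\infty(U):=\max_{1\le i\le k}\big(U_{ii}+\sum_{\ell\ne i}|U_{i\ell}|\big)$ (logarithmic norm). Set $\mu_1:=\mu_\infty(F_1)$, $\mu_1^+:=\max(\mu_1,0)$, $\mu_1^-:=\min(\mu_1,0)$, and for $t\in[0,T]$ $$\Theta(t):=\int_0^t e^{(\mu_1^-+h\mu_1^+)s}\,ds .$$ Carleman truncation of degree $D\ge1$: let $\alpha=(\alpha_1,\dots,\alpha_M)^T$ be the vector of all non-constant monomials $x^\beta$ in $x=(x_1,\dots,x_n)$ of total degree at most $D$ (degrees $1,\dots,D$), ordered by nondecreasing total degree. With the Lie derivative $\mathcal L_f(u)=\sum_{j=1}^n\frac{\partial u}{\partial x_j}f_j$ applied componentwise, there are unique constant matrices $A\in\mathbb R^{M\times M}$ and $B$ such that $\mathcal L_f(\alpha)=A\alpha+B\psi$, where $\psi$ is the vector of the monomials of degrees $D+1,\dots,D+p-1$. The observable is $g(x)=v^T\alpha(x)$ with $v\in\mathbb R^M$ supported on degree $1$, meaning $v_j\neq0$ only if $\deg(\alpha_j)=1$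 (so $g$ is a linear form, the same for all $D$, $v$ being padded with zeros). Set $z_D(t;z_0):=e^{At}\alpha(x_0)$ and $$\epsilon_D(t;x_0):=|v^T\alpha(x(t;x_0))-v^Tz_D(t;z_0)|.$$ Support gap: $k_D:=\lceil (D-h)/h\rceil$, equivalently $k_D+1=\lceil D/h\rceil$. Products: $P_j:=\prod_{r=0}^{j-1}(1+rh)$, $P_0:=1$. $\|v\|_1=\sum_j|v_j|$. *)

(* Defs.v *)
From HB Require Import structures.
From mathcomp Require Import all_boot all_order all_algebra.
From mathcomp Require Import all_classical all_reals all_analysis.
(* The notations of mpoly clash with those of MathComp-Analysis, hence the
   filtered import and the qualified names below. *)
From mathcomp Require Import (canonicals, coercions) mpoly.
Set Implicit Arguments.
Unset Strict Implicit.
Unset Printing Implicit Defensive.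
Import Order.TTheory GRing.Theory Num.Theory.
Import numFieldNormedType.Exports.
Local Open Scope classical_set_scope.
Local Open Scope ring_scope.

Section VectorField.
Context {R : realType} {n : nat}.
Implicit Types (f : 'I_n -> mpoly.mpoly n R) (x : 'cV[R]_n).

Definition mpeval x (q : mpoly.mpoly n R) : R := mpoly.meval (fun i => x i 0) q.

Definition vf f x : 'cV[R]_n := \col_k mpeval x (f k).

(* msize q is 1 + the total degree of q (and 0 if q = 0). *)
Definition vf_deg f : nat := \max_(k < n) (mpoly.msize (f k)).-1.

Definition jacobian0 f : 'M[R]_n :=
  \matrix_(i, j) mpeval 0 (mpoly.mderiv j (f i)).

(* multinomials of total degree < p.+1, i.e. 2 <= |gamma| <= p *)
Definition C2 f : R :=
  \big[Num.max/0]_(i < n)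
    \sum_(g : mpoly.bmultinom n (vf_deg f).+1 | (2 <= mpoly.mdeg g)%N)
      `|mpoly.mcoeff g (f i)|.

Definition lie f (u : mpoly.mpoly n R) : mpoly.mpoly n R :=
  \sum_(j < n) mpoly.mderiv j u * f j.

(* J is an open interval of definition of a solution through x0 at time 0;
   the derivatives are two-sided since J is open. *)
Definition is_solution f (x0 : 'cV[R]_n) (J : set R) (x : R -> 'cV[R]_n) :=
  [/\ open J, is_interval J, J 0, x 0 = x0 &
      forall t, J t -> is_derive t 1 x (vf f (x t))].

End VectorField.

(* For k > 0 the set below is finite and nonempty, so that its sup is the
   maximum over the rows; that value can be negative, which rules out
   \big[Num.max/0]. *)
Definition lognorm_infty {R : realType} k (U : 'M[R]_k) : R :=
  sup (range (fun i : 'I_k => U i i + \sum_(l < k | l != i) `|U i l|)).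

Definition Theta {R : realType} (mu : R) (h : nat) (t : R) : R :=
  \int[lebesgue_measure]_(s in `[0, t])
    expR ((Num.min mu 0 + h%:R * Num.max mu 0) * s).

Definition mxexp {R : realType} k (U : 'M[R]_k) : 'M[R]_k :=
  limn (series (fun j => j`!%:R^-1 *: U ^+ j)).

Section Carleman.
Context {R : realType} {n : nat}.

Definition lists_monomials (a b : nat) M (s : M.-tuple (mpoly.multinom n)) :=
  uniq s /\ forall m, (m \in s) = (a <= mpoly.mdeg m <= b)%N.

Definition by_degree M (s : M.-tuple (mpoly.multinom n)) : bool :=
  sorted (fun m1 m2 => mpoly.mdeg m1 <= mpoly.mdeg m2)%N s.

Definition monomial_vec M (s : M.-tuple (mpoly.multinom n)) :
    'cV[mpoly.mpoly n R]_M :=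
  \col_i mpoly.mpolyX R (tnth s i).

Definition monomial_val M (s : M.-tuple (mpoly.multinom n)) (x : 'cV[R]_n) :
    'cV[R]_M :=
  map_mx (mpeval x) (monomial_vec s).

Definition constmx M N (U : 'M[R]_(M, N)) : 'M[mpoly.mpoly n R]_(M, N) :=
  map_mx (@mpoly.mpolyC n R) U.

(* L_f(alpha) = A alpha + B psi, as an identity between vectors of polynomials *)
Definition carleman_rel (f : 'I_n -> mpoly.mpoly n R)
    M (alpha : M.-tuple (mpoly.multinom n)) (A : 'M[R]_M)
    N (psi : N.-tuple (mpoly.multinom n)) (B : 'M[R]_(M, N)) :=
  map_mx (lie f) (monomial_vec alpha)
  = constmx A *m monomial_vec alpha + constmx B *m monomial_vec psi.

Definition deg1_supported M (alpha : M.-tuple (mpoly.multinom n))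
    (v : 'cV[R]_M) :=
  forall j, v j 0 != 0 -> mpoly.mdeg (tnth alpha j) = 1%N.

Definition carleman_flow M (alpha : M.-tuple (mpoly.multinom n)) (A : 'M[R]_M)
    (x0 : 'cV[R]_n) (t : R) : 'cV[R]_M :=
  mxexp (t *: A) *m monomial_val alpha x0.

Definition carleman_error M (alpha : M.-tuple (mpoly.multinom n))
    (A : 'M[R]_M) (v : 'cV[R]_M) (x : R -> 'cV[R]_n) (x0 : 'cV[R]_n)
    (t : R) : R :=
  `|(v^T *m monomial_val alpha (x t)) 0 0
    - (v^T *m carleman_flow alpha A x0 t) 0 0|.

End Carleman.

Definition l1norm {R : realType} M (v : 'cV[R]_M) : R := \sum_j `|v j 0|.

(* ceil ((D - h) / h), computed in rat; it is > -1, hence nonnegative, as soon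
   as 1 <= D and 1 <= h, so that the absolute value is only a cast to nat. *)
Definition support_gap (D h : nat) : nat :=
  `|Num.ceil ((D%:R - h%:R) / h%:R : rat)|%N.

Definition Pprod (h j : nat) : nat := (\prod_(0 <= r < j) (1 + r * h))%N.

(* Main.v *)
Require Import Defs.
From HB Require Import structures.
From mathcomp Require Import all_boot all_order all_algebra.
From mathcomp Require Import all_classical all_reals all_analysis.
From mathcomp Require Import (canonicals, coercions) mpoly.
From mathcomp Require Import ring lra zify.
Set Implicit Arguments.
Unset Strict Implicit.
Unset Printing Implicit Defensive.
Import Order.TTheory GRing.Theory Num.Theory.
Import numFieldNormedType.Exports.
Local Open Scope classical_set_scope.
Local Open Scope ring_scope.

(** The error E(s) = alpha(x(s)) - exp(sA) alpha(x0) solves the linear system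
    E' = A E + B psi(x(s)), E(0) = 0, and the claim bounds v^T E(t).

    Three features of the rows of A and B carry the estimate; write i for a row
    whose monomial has degree k.  The entries that preserve the degree have
    logarithmic norm at most k mu_1, because on monomials of degree k the linear
    part of f acts as a sum of k copies of its Jacobian
    ([lie_coeff_lognorm]).  The entries that raise the degree, those of B
    included, have absolute sum at most k C_2 ([lie_coeff_raise]).  All nonzero
    entries raise the degree by an amount between 0 and h
    ([lie_coeff_support]).  So v^T exp(tau A), which starts in degree 1, is
    carried upwards by jumps, the j-th of which starts in degree at most
    1 + (j-1)h and hence costs a factor at most (1 + (j-1)h) C_2: this produces
    P_j C_2^j.  The source B psi lives in the rows of degree k > D - h, which
    take at least k_D jumps to reach, and in the truncated system at most D - 1
    jumps are possible.

    Rather than expanding exp(tau A) into iterated integrals over jump times,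
    the proof exhibits an explicit supersolution that depends on the monomial
    only through its degree k:

      rho_k(s) = exp(k mu_1 s) sum_j (prod_(r < j) (k + r h)) C_2^j Theta(s)^j / j!

    where j ranges over the numbers of jumps that lead from degree k into the
    degrees above D - h without leaving the degrees up to D ([jump_bound]).  Its
    derivative is k mu_1 rho_k plus k C_2 times an upper bound for rho_l,
    k < l <= k + h, because k prod_(r < j) (k + h + r h) is the next product and
    because exp((l - k) mu_1 s) <= exp((mu_1^- + h mu_1^+) s) = Theta'(s)
    ([is_derive_jump_bound], [jump_bound_le]).  The comparison principle
    [linear_comparison] turns the inequality rho' >= A rho (with absolute
    values off the diagonal) into |E_i(t)| <= K int_0^t rho_1 for the rows i of
    degree 1.  Here K = D C_2 R^(D+1) R_+^(h-1) bounds the source, which is the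
    last jump, out of a degree at most D, applied to monomials of degrees
    D + 1, ..., D + h.  Finally int_0^t rho_1 is at most the sum in the claim
    because exp(mu_1 s) <= Theta'(s). *)

(** * The matrix exponential *)

Section MatrixExponential.
Variable R : realType.

Lemma cvg_mx_entries m n (u : nat -> 'M[R]_(m, n)) (l : 'M[R]_(m, n)) :
  (forall i j, (fun N => u N i j) @ \oo --> l i j) -> u @ \oo --> l.
Proof.
move=> ul; apply/cvgrPdist_le => /= e e0; near=> N.
rewrite /Num.Def.normr/= mx_normrE (bigmax_le _ (ltW e0))//= => i _.
rewrite !mxE; move: i; near: N; apply: filter_forall => /= i.
exact: ((cvgrPdist_le _ _).1 (ul i.1 i.2)).
Unshelve. all: by end_near. Qed.

Lemma cvg_sumr k (u : 'I_k -> nat -> R) (a : 'I_k -> R) :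
  (forall l, u l @ \oo --> a l) -> (fun N => \sum_l u l N) @ \oo --> \sum_l a l.
Proof.
move=> ua; rewrite -[X in X @ _ --> _](_ : \sum_l u l = _); last first.
  by apply/funext => N; rewrite fct_sumE.
by elim/big_ind2 : _ => // [|*]; [exact: cvg_cst|exact: cvgD].
Qed.

Lemma cvg_pseries_fact (c : R ^nat) (C K t : R) : 0 <= C -> 0 <= K ->
  (forall m, `|c m| <= C * (K ^+ m / m`!%:R)) -> cvgn (pseries c t).
Proof.
move=> C0 K0 cK; apply: normed_cvg.
apply: (@series_le_cvg _ _ (C *: exp_coeff (K * `|t|))) => [m|m|m|].
- exact: normr_ge0.
- by rewrite /= mulr_ge0// exp_coeff_ge0// mulr_ge0.
- rewrite /=; rewrite normrM normrX /GRing.scale /= /exp_coeff /= exprMn.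
  rewrite [leRHS](_ : _ = (C * (K ^+ m / m`!%:R)) * `|t| ^+ m); last by rewrite -!mulrA [_ ^-1 * _]mulrC.
  by rewrite ler_wpM2r// exprn_ge0.
- by rewrite /= ; apply: is_cvg_seriesZ; exact: is_cvg_series_exp_coeff.
Qed.

(** Taylor coefficients of the entries of exp(tU) V.  The extra factor V makes
    the family stable under differentiation, which replaces V by U V. *)
Definition mxexp_coef k (U V : 'M[R]_k) i j : R ^nat :=
  fun m => (m`!%:R)^-1 * (U ^+ m *m V) i j.

Lemma mx_exp_entry_le k (U V : 'M[R]_k) i j m :
  `|(U ^+ m *m V) i j| <= (\sum_a \sum_b `|V a b|) * (\sum_a \sum_b `|U a b|) ^+ m.
Proof.
elim: m i j => [|m IH] i j.
  rewrite !expr0 mul1mx mulr1 (bigD1 i)//= (bigD1 j)//= -addrA lerDl.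
  by rewrite addr_ge0// sumr_ge0// => a _; rewrite sumr_ge0.
rewrite !exprS -mulmxA mxE (le_trans (ler_norm_sum _ _ _))//.
set C := \sum_a \sum_b `|V a b|.
rewrite (@le_trans _ _ (\sum_l `|U i l| * (C * (\sum_a \sum_b `|U a b|) ^+ m)))//.
  by apply: ler_sum => l _; rewrite normrM ler_wpM2l.
rewrite -mulr_suml mulrCA ler_wpM2l//.
  by rewrite sumr_ge0// => a _; rewrite sumr_ge0.
rewrite ler_wpM2r//.
  by rewrite exprn_ge0// sumr_ge0// => a _; rewrite sumr_ge0.
by rewrite [leRHS](bigD1 i)//= lerDl sumr_ge0// => a _; rewrite sumr_ge0.
Qed.

Lemma cvg_mxexp_coef k (U V : 'M[R]_k) i j t :
  cvgn (pseries (mxexp_coef U V i j) t).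
Proof.
set K := \sum_a \sum_b `|U a b|; set C := \sum_a \sum_b `|V a b|.
have K0 : 0 <= K by rewrite sumr_ge0// => a _; rewrite sumr_ge0.
have C0 : 0 <= C by rewrite sumr_ge0// => a _; rewrite sumr_ge0.
apply: (@cvg_pseries_fact _ C K) => // m; rewrite /mxexp_coef normrM.
rewrite [leLHS]mulrC [leRHS]mulrA [X in _ * X <= _]ger0_norm ?invr_ge0 ?ler0n//.
rewrite ler_wpM2r ?invr_ge0 ?ler0n//.
exact: mx_exp_entry_le.
Qed.

Lemma scalemx_exp k (U : 'M[R]_k) (t : R) m : (t *: U) ^+ m = t ^+ m *: U ^+ m.
Proof.
elim: m => [|m IH]; first by rewrite !expr0 scale1r.
rewrite !exprS IH; transitivity ((t *: U) *m (t ^+ m *: U ^+ m)) => //.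
by rewrite -scalemxAl -scalemxAr scalerA.
Qed.

Lemma cvg_mxexp k (U : 'M[R]_k) t i j :
  pseries (mxexp_coef U 1%:M i j) t @ \oo --> mxexp (t *: U) i j.
Proof.
pose L : 'M[R]_k := \matrix_(i, j) limn (pseries (mxexp_coef U 1%:M i j) t).
suff -> : mxexp (t *: U) = L by rewrite mxE; exact: cvg_mxexp_coef.
apply: cvg_lim => //; apply: cvg_mx_entries => {}i {}j.
rewrite mxE (_ : (fun N => _) = pseries (mxexp_coef U 1%:M i j) t).
  exact: cvg_mxexp_coef.
apply/funext => N; rewrite /pseries /series /= summxE; apply: eq_bigr => m _.
by rewrite /mxexp_coef mulmx1 scalemx_exp !mxE mulrA mulrAC.
Qed.

Lemma cvg_mxexp_mul k (U V : 'M[R]_k) t i j :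
  pseries (mxexp_coef U V i j) t @ \oo --> (mxexp (t *: U) *m V) i j.
Proof.
rewrite mxE (_ : pseries _ _ =
    fun N => \sum_l pseries (mxexp_coef U 1%:M i l) t N * V l j).
  by apply: cvg_sumr => l; apply: cvgMr_tmp; exact: cvg_mxexp.
apply/funext => N; rewrite /pseries /series /=.
under [RHS]eq_bigr do rewrite mulr_suml.
rewrite exchange_big /=; apply: eq_bigr => m _.
rewrite /mxexp_coef mulmx1 mxE mulr_sumr mulr_suml; apply: eq_bigr => l _.
by rewrite !mulrA mulrAC.
Qed.

Lemma mxexp_coef_diffs k (U V : 'M[R]_k) i j :
  pseries_diffs (mxexp_coef U V i j) = mxexp_coef U (U *m V) i j.
Proof.
apply/funext => m.
by rewrite /pseries_diffs /mxexp_coef factS natrM invfM mulrA mulVKf// exprSr mulmxA.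
Qed.

Lemma is_derive_mxexp k (U : 'M[R]_k) i j (t : R) :
  is_derive t (1 : R) (fun s : R => mxexp (s *: U) i j) ((mxexp (t *: U) *m U) i j).
Proof.
have E V s : (mxexp (s *: U) *m V) i j = limn (pseries (mxexp_coef U V i j) s).
  by apply/esym/cvg_lim => //; exact: cvg_mxexp_mul.
rewrite (_ : (fun s => _) = fun s => limn (pseries (mxexp_coef U 1%:M i j) s)); last first.
  by apply/funext => s; rewrite -E mulmx1.
rewrite E (_ : mxexp_coef U U i j = pseries_diffs (mxexp_coef U 1%:M i j)); last first.
  by rewrite mxexp_coef_diffs mulmx1.
apply: (@pseries_snd_diffs _ _ (`|t| + 1));
  rewrite ?mxexp_coef_diffs; try exact: cvg_mxexp_coef.
by rewrite [ltRHS]ger0_norm ?addr_ge0// ltrDl.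
Qed.

(** Every partial sum commutes with U. *)
Lemma mxexp_comm k (U : 'M[R]_k) t : mxexp (t *: U) *m U = U *m mxexp (t *: U).
Proof.
apply/matrixP => i j; apply: (cvg_unique _ (@cvg_mxexp_mul _ U U t i j)) => //.
rewrite mxE (_ : pseries _ _ =
    fun N => \sum_l U i l * pseries (mxexp_coef U 1%:M l j) t N).
  by apply: cvg_sumr => l; apply: cvgMl_tmp; exact: cvg_mxexp.
apply/funext => N; rewrite /pseries /series /=.
under [RHS]eq_bigr do rewrite mulr_sumr.
rewrite exchange_big /=; apply: eq_bigr => m _.
rewrite /mxexp_coef.
have -> : U ^+ m *m U = U *m U ^+ m by rewrite -[LHS]/(U ^+ m * U) -exprSr exprS.
rewrite mxE mulr_sumr mulr_suml; apply: eq_bigr => l _.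
by rewrite mulmx1 !mulrA [U i l * _]mulrC.
Qed.

Lemma mxexp0 k (U : 'M[R]_k) : mxexp (0 *: U) = 1%:M.
Proof.
apply/matrixP => i j; apply: (cvg_unique _ (@cvg_mxexp _ U 0 i j)) => //.
apply: cvg_near_cst; near=> N.
have /prednK <- : (0 < N)%N by near: N; exact: nbhs_infty_gt.
rewrite /pseries /series /= big_nat_recl//= big1 => [|m _].
  by rewrite addr0 expr0 mulr1 /mxexp_coef expr0 mulmx1 fact0 invr1 mul1r.
by rewrite exprS mul0r mulr0.
Unshelve. all: by end_near. Qed.

(** The exponential series is dominated termwise by the one of the matrix of
    absolute values. *)
Lemma mxexp_norm_le k (U : 'M[R]_k) (t : R) i j : 0 <= t ->
  `|mxexp (t *: U) i j| <= mxexp (t *: map_mx Num.norm U) i j.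
Proof.
move=> t0; have H m a b : `|(U ^+ m) a b| <= ((map_mx Num.norm U) ^+ m) a b.
  elim: m a b => [|m IH] a b.
    by rewrite !expr0 mxE; case: eqP => _; rewrite ?normr1 ?normr0.
  rewrite !exprS !mxE (le_trans (ler_norm_sum _ _ _))//.
  by apply: ler_sum => l _; rewrite normrM mxE ler_wpM2l.
have c1 := cvg_norm (@cvg_mxexp _ U t i j).
have c2 := @cvg_mxexp _ (map_mx Num.norm U) t i j.
apply: (ler_cvg_to (c1 _) c2); near=> N.
rewrite /pseries /series /= (le_trans (ler_norm_sum _ _ _))//.
apply: ler_sum => m _; rewrite /mxexp_coef !mulmx1 normrM.
rewrite [`|t ^+ m|]ger0_norm ?exprn_ge0// ler_wpM2r ?exprn_ge0//.
by rewrite normrM ger0_norm ?invr_ge0 ?ler0n// ler_wpM2l ?invr_ge0 ?ler0n.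
Unshelve. all: by end_near. Qed.

End MatrixExponential.

(** * Comparison principle for linear systems *)

Section Comparison.
Variable R : realType.

Lemma ge0_is_derive_le (f df : R -> R) (t : R) : 0 <= t ->
  (forall s, 0 <= s <= t -> is_derive s (1 : R) f (df s)) ->
  (forall s, 0 <= s <= t -> 0 <= df s) -> f 0 <= f t.
Proof.
move=> t0 fdf df0.
have itvW s : s \in `]0, t[ -> 0 <= s <= t.
  by rewrite in_itv /= => /andP[/ltW -> /ltW ->].
apply: (@ger0_derive1_ndecr _ f 0 t) => // [s /itvW st|s /itvW st|].
- exact: (@ex_derive _ _ _ _ _ _ _ (fdf s st)).
- by rewrite derive1E (@derive_val _ _ _ _ _ _ _ (fdf s st)) df0.
- apply: derivable_within_continuous => s; rewrite in_itv /= => st.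
  exact: (@ex_derive _ _ _ _ _ _ _ (fdf s st)).
Qed.

Lemma is_derive_dot k (y z dy dz : 'I_k -> R -> R) (s : R) :
  (forall l, is_derive s (1 : R) (y l) (dy l s)) ->
  (forall l, is_derive s (1 : R) (z l) (dz l s)) ->
  is_derive s (1 : R) (fun u => \sum_l y l u * z l u)
    (\sum_l (y l s * dz l s + dy l s * z l s)).
Proof.
move=> hy hz.
rewrite (_ : (fun u => _) = \sum_l (y l * z l)); last first.
  by apply/funext => u; rewrite fct_sumE.
by apply: is_derive_sum => l; apply: is_derive_eq; rewrite [dy l s * _]mulrC.
Qed.

Lemma is_derive_chain (f g : R -> R) (s df dg : R) :
  is_derive (g s) (1 : R) f df -> is_derive s (1 : R) g dg ->
  is_derive s (1 : R) (fun u => f (g u)) (df * dg).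
Proof.
move=> [f1 f2] [g1 g2]; split.
  apply/derivable1_diffP.
  by apply: (@differentiable_comp _ _ _ _ g f); exact/derivable1_diffP.
by rewrite -[LHS]derive1E (@derive1_comp _ g f)// !derive1E f2 g2.
Qed.

Lemma is_derive_scale (c : R) (g : R -> R) (s dg : R) :
  is_derive s (1 : R) g dg -> is_derive s (1 : R) (fun u => c * g u) (c * dg).
Proof. by move=> gP; exact: (is_deriveZ c gP). Qed.

Lemma is_derive_compl (f : R -> R) (t s df : R) :
  is_derive (t - s) (1 : R) f df -> is_derive s (1 : R) (fun u => f (t - u)) (- df).
Proof.
move=> h; have h2 : is_derive s (1 : R) (fun u : R => t - u) (- 1).
  by apply: is_derive_eq (is_deriveB (is_derive_cst t s 1) (is_derive_id s 1)) _; rewrite sub0r.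
by apply: is_derive_eq (@is_derive_chain f (fun u => t - u) s _ _ h h2) _; rewrite mulrN1.
Qed.

Lemma is_derive_expR_lin (c s : R) :
  is_derive s (1 : R) (fun u => expR (c * u)) (c * expR (c * s)).
Proof.
have h : is_derive s (1 : R) (fun u : R => c * u) c.
  by apply: is_derive_eq (is_deriveZ c (is_derive_id s 1)) _; rewrite /GRing.scale /= mulr1.
by apply: is_derive_eq (@is_derive_chain expR ( *%R c) s _ _ (is_derive_expR _) h) _; rewrite mulrC.
Qed.

(** Variation of constants: when P = A + c, the factor multiplying
    exp((t - s)P) in the derivative is e^(cs) (Y' - A Y), the residual of Y in
    the system with matrix A. *)
Lemma is_derive_propagated k (P : 'M[R]_k) (c t : R) (Y dY : 'I_k -> R -> R) i s :
  (forall l, is_derive s (1 : R) (Y l) (dY l s)) ->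
  is_derive s (1 : R)
    (fun u => \sum_l mxexp ((t - u) *: P) i l * (expR (c * u) * Y l u))
    (\sum_l mxexp ((t - s) *: P) i l *
       (expR (c * s) * (dY l s + c * Y l s - \sum_m P l m * Y m s))).
Proof.
move=> hY.
have hz l : is_derive s (1 : R) (fun u => expR (c * u) * Y l u)
    (expR (c * s) * dY l s + c * expR (c * s) * Y l s).
  by apply: is_derive_eq (is_deriveM (is_derive_expR_lin c s) (hY l)) _;
     rewrite /GRing.scale /= [Y l s * _]mulrC.
have hy l : is_derive s (1 : R) (fun u => mxexp ((t - u) *: P) i l)
    (- (mxexp ((t - s) *: P) *m P) i l).
  exact: is_derive_compl (is_derive_mxexp _ _ _ _).
apply: is_derive_eq
  (@is_derive_dot k _ _ (fun l u => - (mxexp ((t - u) *: P) *m P) i l)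
    (fun l u => expR (c * u) * dY l u + c * expR (c * u) * Y l u) s hy hz) _.
rewrite big_split /=.
have -> : \sum_l - (mxexp ((t - s) *: P) *m P) i l * (expR (c * s) * Y l s) =
  - \sum_l mxexp ((t - s) *: P) i l * (expR (c * s) * \sum_m P l m * Y m s).
  under eq_bigr do rewrite mulNr mxE mulr_suml.
  rewrite sumrN exchange_big; congr (- _); apply: eq_bigr => m _.
  rewrite !mulr_sumr; apply: eq_bigr => l _.
  by rewrite -mulrA; congr (_ * _); rewrite mulrCA.
rewrite -sumrN -big_split /=; apply: eq_bigr => l _.
by rewrite -mulrBr -[c * _ * _]mulrA [c * (_ * _)]mulrCA -mulrDr -mulrBr.
Qed.

Lemma sum_mxexp0 k (U : 'M[R]_k) i (y : 'I_k -> R) :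
  \sum_l mxexp (0 *: U) i l * y l = y i.
Proof.
rewrite mxexp0 (bigD1 i)//= mxE eqxx mul1r big1 ?addr0// => l li.
by rewrite mxE eq_sym (negbTE li) mul0r.
Qed.

(** A shift by c makes the diagonal of P = A + c nonnegative, so that the matrix
    Q of absolute values of P has the off-diagonal entries |A_lm| and the
    shifted diagonal of A: the differential inequality for rho is exactly
    rho' >= (Q - c) rho.  As exp(sQ) >= 0, variation of constants yields
    exp(s(Q - c)) G <= rho(s).  As |exp(sP)| <= exp(sQ), the response of E_i to
    a source bounded by G is then at most the integral of rho_i. *)
Lemma linear_comparison k (A : 'M[R]_k) (E F rho drho : 'I_k -> R -> R)
    (G : 'I_k -> R) (H dH : R -> R) (i : 'I_k) (t : R) :
  0 <= t ->
  (forall l s, 0 <= s <= t ->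
     is_derive s (1 : R) (E l) (\sum_m A l m * E m s + F l s)) ->
  (forall l, E l 0 = 0) ->
  (forall l s, 0 <= s <= t -> `|F l s| <= G l) ->
  (forall l s, 0 <= s <= t -> is_derive s (1 : R) (rho l) (drho l s)) ->
  (forall l, G l <= rho l 0) ->
  (forall l s, 0 <= s <= t ->
     A l l * rho l s + \sum_(m | m != l) `|A l m| * rho m s <= drho l s) ->
  (forall s, 0 <= s <= t -> is_derive s (1 : R) H (dH s)) ->
  (forall s, 0 <= s <= t -> rho i s <= dH s) ->
  `|E i t| <= H t - H 0.
Proof.
move=> t0 dE E0 FG drhoP Grho rho_super dHP rhoH.
pose c := \sum_l `|A l l|.
have cA l : 0 <= A l l + c.
  rewrite -lerBlDl sub0r (le_trans (ler_norm _))// normrN.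
  by rewrite /c (bigD1 l)//= lerDl sumr_ge0.
pose P := A + c%:M; pose Q := map_mx Num.norm P.
have PE l (y : 'I_k -> R) : \sum_m P l m * y m = \sum_m A l m * y m + c * y l.
  under eq_bigr do rewrite !mxE mulrDl.
  rewrite big_split /=; congr (_ + _); rewrite (bigD1 l)//= eqxx mulr1n.
  by rewrite big1 ?addr0// => m /negbTE; rewrite eq_sym => ->; rewrite mulr0n mul0r.
have QE l (y : 'I_k -> R) : \sum_m Q l m * y m =
    A l l * y l + c * y l + \sum_(m | m != l) `|A l m| * y m.
  rewrite (bigD1 l)//= !mxE eqxx mulr1n ger0_norm// mulrDl; congr (_ + _).
  apply: eq_bigr => m /negbTE; rewrite eq_sym => lm.
  by rewrite !mxE lm mulr0n addr0.
have Qge0 s l : 0 <= s -> 0 <= mxexp (s *: Q) i l.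
  by move=> s0; rewrite (le_trans _ (mxexp_norm_le _ _ _ s0)).
(* chi is nondecreasing because rho is a supersolution and exp((s - u)Q) >= 0 *)
have majorant s : 0 <= s <= t ->
    \sum_l mxexp (s *: Q) i l * G l <= expR (c * s) * rho i s.
  move=> /andP[s0 st].
  have ut u : 0 <= u <= s -> 0 <= u <= t.
    by move=> /andP[-> us]; rewrite (le_trans us).
  pose chi u := \sum_l mxexp ((s - u) *: Q) i l * (expR (c * u) * rho l u).
  have chis : chi s = expR (c * s) * rho i s by rewrite /chi (subrr s) sum_mxexp0.
  have chi0 : \sum_l mxexp (s *: Q) i l * G l <= chi 0.
    rewrite /chi (subr0 s) mulr0 expR0; apply: ler_sum => l _.
    by rewrite mul1r ler_wpM2l// Qge0.
  apply: (le_trans chi0); rewrite -chis.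
  apply: (ge0_is_derive_le s0 (fun u us => @is_derive_propagated _ Q c s rho drho i u
    (fun l => drhoP l u (ut u us)))) => u us; apply: sumr_ge0 => l _.
  apply: mulr_ge0; first by apply: Qge0; rewrite subr_ge0; case/andP: us.
  rewrite mulr_ge0 ?expR_ge0// subr_ge0 QE.
  by rewrite addrAC lerD2r rho_super// ut.
pose phi u := \sum_l mxexp ((t - u) *: P) i l * (expR (c * u) * E l u).
pose dphi u := \sum_l mxexp ((t - u) *: P) i l * (expR (c * u) * F l u).
have dphiP u : 0 <= u <= t -> is_derive u (1 : R) phi (dphi u).
  move=> ut; apply: is_derive_eq (@is_derive_propagated _ P c t E
    (fun l s => \sum_m A l m * E m s + F l s) i u (fun l => dE l u ut)) _.
  apply: eq_bigr => l _; rewrite PE; congr (_ * (_ * _)).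
  by move: (\sum_m _) (c * _) => a b; ring.
pose psi u := - expR (c * t) * H (t - u).
pose dpsi u := expR (c * t) * dH (t - u).
have tB u : 0 <= u <= t -> 0 <= t - u <= t.
  by move=> /andP[u0 ut]; rewrite subr_ge0 ut gerBl.
have dpsiP u : 0 <= u <= t -> is_derive u (1 : R) psi (dpsi u).
  move=> /tB ut.
  apply: is_derive_eq (is_deriveZ (- expR (c * t)) (is_derive_compl (dHP _ ut))) _.
  by rewrite /GRing.scale /= mulrNN.
have dphi_le u : 0 <= u <= t -> `|dphi u| <= dpsi u.
  move=> ut; have tu := tB u ut.
  apply: (@le_trans _ _ (expR (c * u) * \sum_l mxexp ((t - u) *: Q) i l * G l)).
    rewrite (le_trans (ler_norm_sum _ _ _))// mulr_sumr; apply: ler_sum => l _.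
    rewrite mulrCA normrM ger0_norm ?expR_ge0// ler_wpM2l ?expR_ge0// normrM.
    apply: ler_pM => //; last exact: FG.
    by apply: mxexp_norm_le; case/andP: tu.
  rewrite (@le_trans _ _ (expR (c * u) * (expR (c * (t - u)) * rho i (t - u))))//.
    by rewrite ler_wpM2l ?expR_ge0// majorant.
  by rewrite mulrA -expRD -mulrDr subrKC ler_wpM2l ?expR_ge0// rhoH.
have phi0 : phi 0 = 0 by rewrite /phi big1// => l _; rewrite E0 !mulr0.
have phit : phi t = expR (c * t) * E i t by rewrite /phi (subrr t) sum_mxexp0.
have psi0t : psi t - psi 0 = expR (c * t) * (H t - H 0).
  by rewrite /psi subrr subr0 !mulNr opprK addrC mulrBr.
have up : (psi - phi) 0 <= (psi - phi) t.
  apply: (@ge0_is_derive_le _ (dpsi - dphi)) => // s st.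
    exact: (is_deriveB (dpsiP s st) (dphiP s st)).
  by rewrite subr_ge0 (le_trans (ler_norm _)) ?dphi_le.
have down : (psi + phi) 0 <= (psi + phi) t.
  apply: (@ge0_is_derive_le _ (dpsi + dphi)) => // s st.
    exact: (is_deriveD (dpsiP s st) (dphiP s st)).
  by rewrite -lerBlDr sub0r (le_trans (ler_norm _))// normrN dphi_le.
rewrite -(ler_pM2l (expR_gt0 (c * t))) -psi0t.
have -> : expR (c * t) * `|E i t| = `|phi t| by rewrite phit normrM ger0_norm ?expR_ge0.
move: up down; rewrite /= !fctE phi0 subr0 addr0 ler_norml => up down.
by apply/andP; split; lra.
Qed.

End Comparison.

(** * Coefficients of Lie derivatives of monomials *)

Section Coefficients.
Variables (R : realType) (n : nat).
Implicit Types (f : 'I_n -> mpoly.mpoly n R) (q : mpoly.mpoly n R).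
Implicit Types (b m g : mpoly.multinom n).

Lemma mpeval0 q : mpeval 0 q = mpoly.mcoeff mpoly.mnm0 q.
Proof.
rewrite /mpeval; elim/mpoly.mpolyind: q => [|c m q _ _ IH].
  by rewrite mpoly.meval0 mpoly.mcoeff0.
rewrite mpoly.mevalD mpoly.mcoeffD IH mpoly.mevalZ mpoly.mcoeffZ; congr (_ * _ + _).
rewrite mpoly.mevalX mpoly.mcoeffX.
have [->|m0] := eqVneq m mpoly.mnm0.
  by rewrite big1// => i _; rewrite mpoly.mnm0E expr0.
have [i mi] : exists i, m i != 0%N.
  apply/existsP; apply: contraNT m0; rewrite negb_exists => /forallP h.
  apply/eqP/mpoly.mnmP => i; rewrite mpoly.mnm0E; apply/eqP.
  by have := h i; rewrite negbK.
by rewrite (bigD1 i)//= mxE expr0n (negbTE mi) mul0r.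
Qed.

Lemma jacobian0E f i j : jacobian0 f i j = mpoly.mcoeff (mpoly.mnm1 j) (f i).
Proof.
rewrite mxE mpeval0 mpoly.mcoeff_mderiv mpoly.mnm0E mulr1n.
congr mpoly.mcoeff; apply/mpoly.mnmP => l.
by rewrite mpoly.mnmDE mpoly.mnm0E add0n.
Qed.

Lemma mpoly_linear_higher d q :
  (mpoly.mmeasure mpoly.mdeg q <= d)%N -> mpoly.mcoeff mpoly.mnm0 q = 0 ->
  q = \sum_k mpoly.mcoeff (mpoly.mnm1 k) q *: mpoly.mpolyX R (mpoly.mnm1 k)
    + \sum_(g : mpoly.bmultinom n d | (2 <= mpoly.mdeg g)%N)
        mpoly.mcoeff g q *: mpoly.mpolyX R g.
Proof.
move=> qd q0; apply/mpoly.mpolyP => m; rewrite mpoly.mcoeffD !raddf_sum /=.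
under eq_bigr do rewrite mpoly.mcoeffZ mpoly.mcoeffX.
under [X in _ = _ + X]eq_bigr do rewrite mpoly.mcoeffZ mpoly.mcoeffX.
have [m2|m1] := leqP 2 (mpoly.mdeg m).
  rewrite [X in _ = X + _]big1 ?add0r; last first.
    move=> k _; case: eqP m2 => [<-|_ _]; last by rewrite mulr0.
    by rewrite mpoly.mdeg1.
  have [md|md] := ltnP (mpoly.mdeg m) d.
    rewrite (bigD1 (mpoly.BMultinom md))//= eqxx mulr1 big1 ?addr0// => g.
    case/andP=> _ gm; case: eqP => [E|_]; last by rewrite mulr0.
    by case/eqP: gm; exact: val_inj.
  rewrite big1 => [|g _].
    apply/eqP; rewrite mpoly.mcoeff_eq0; apply/negP => /mpoly.msize_mdeg_lt.
    by move=> /leq_trans/(_ qd); rewrite ltnNge md.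
  case: eqP => [E|_]; last by rewrite mulr0.
  by have := mpoly.bmdeg g; rewrite E ltnNge md.
rewrite [X in _ = _ + X]big1 ?addr0; last first.
  move=> g g2; case: eqP => [E|_]; last by rewrite mulr0.
  by move: g2; rewrite E leqNgt m1.
have : (mpoly.mdeg m == 0%N) || (mpoly.mdeg m == 1%N) by lia.
case/orP; first rewrite mpoly.mdeg_eq0 => /eqP ->.
  by rewrite q0 big1// => k _; rewrite mpoly.mnm1_eq0 mulr0.
move=> /mpoly.mdeg1P[i /eqP ->].
rewrite (bigD1 i)//= eqxx mulr1 big1 ?addr0// => k ki.
case: eqP => [/mpoly.mnmP/(_ k)|_]; last by rewrite mulr0.
by rewrite !mpoly.mnm1E eqxx eq_sym (negbTE ki).
Qed.

Lemma msize_vf_deg f j : (mpoly.mmeasure mpoly.mdeg (f j) <= (vf_deg f).+1)%N.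
Proof.
have := @leq_bigmax _ (fun k => (mpoly.mmeasure mpoly.mdeg (f k)).-1) j.
by rewrite -/(vf_deg f); lia.
Qed.

(** Replacing one factor x_j of x^b by the linear part of f_j, resp. by its part
    of degree at least 2 ([lie_high]), gives these coefficients at x^m.  When
    b j = 0 the truncated subtraction of exponents makes them meaningless, but
    then they are multiplied by b j in [lie_coeff]. *)
Definition lie_lin f b m j : R :=
  \sum_k jacobian0 f j k *
    (m == mpoly.mnm_add (mpoly.mnm_sub b (mpoly.mnm1 j)) (mpoly.mnm1 k))%:R.

Definition lie_high f b m j : R :=
  \sum_(g : mpoly.bmultinom n (vf_deg f).+1 | (2 <= mpoly.mdeg g)%N)
    mpoly.mcoeff g (f j) *
    (m == mpoly.mnm_add (mpoly.mnm_sub b (mpoly.mnm1 j)) g)%:R.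

Lemma lie_coeff f b m : (forall j, mpoly.mcoeff mpoly.mnm0 (f j) = 0) ->
  mpoly.mcoeff m (lie f (mpoly.mpolyX R b))
  = \sum_j (b j)%:R * (lie_lin f b m j + lie_high f b m j).
Proof.
move=> f0; rewrite /lie raddf_sum; apply: eq_bigr => j _.
rewrite /= mpoly.mderivX -scalerAl mpoly.mcoeffZ; congr (_ * _).
rewrite {1}(mpoly_linear_higher (msize_vf_deg f j) (f0 j)) mulrDr mpoly.mcoeffD.
rewrite !mulr_sumr !raddf_sum; congr (_ + _); apply: eq_bigr => k _ /=.
  rewrite -scalerAr -mpoly.mpolyXD mpoly.mcoeffZ mpoly.mcoeffX jacobian0E.
  by rewrite eq_sym.
by rewrite -scalerAr -mpoly.mpolyXD mpoly.mcoeffZ mpoly.mcoeffX eq_sym.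
Qed.

Lemma mdeg_shift b g j : b j != 0%N ->
  (mpoly.mdeg (mpoly.mnm_add (mpoly.mnm_sub b (mpoly.mnm1 j)) g)).+1
  = (mpoly.mdeg b + mpoly.mdeg g)%N.
Proof.
move=> bj; have E : b = mpoly.mnm_add (mpoly.mnm_sub b (mpoly.mnm1 j)) (mpoly.mnm1 j).
  apply/mpoly.mnmP => i; rewrite mpoly.mnmDE mpoly.mnmBE mpoly.mnm1E.
  by case: eqP => [<-|_]; rewrite ?subn0 ?addn0// subnK// lt0n.
by rewrite {2}E !mpoly.mdegD mpoly.mdeg1 addn1 addSn.
Qed.

Lemma lie_lin_eq0 f b m j : b j != 0%N -> mpoly.mdeg m != mpoly.mdeg b ->
  lie_lin f b m j = 0.
Proof.
move=> bj mb; rewrite /lie_lin big1// => k _; case: eqP => [E|]; last by rewrite mulr0.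
have := mdeg_shift (mpoly.mnm1 k) bj; rewrite -E mpoly.mdeg1 addn1 => -[Emb].
by rewrite Emb eqxx in mb.
Qed.

Lemma lie_high_eq0 f b m j : b j != 0%N ->
  ~~ (mpoly.mdeg b < mpoly.mdeg m <= mpoly.mdeg b + (vf_deg f).-1)%N ->
  lie_high f b m j = 0.
Proof.
move=> bj mb; rewrite /lie_high big1// => g g2; case: eqP => [E|]; last by rewrite mulr0.
have := mdeg_shift g bj; rewrite -E => Emb.
have := mpoly.bmdeg g; lia.
Qed.

Lemma mdegE_sum b : (mpoly.mdeg b)%:R = \sum_j (b j)%:R :> R.
Proof. by rewrite mpoly.mdegE natr_sum. Qed.

Lemma lie_coeff_support f b m : (forall j, mpoly.mcoeff mpoly.mnm0 (f j) = 0) ->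
  ~~ (mpoly.mdeg b <= mpoly.mdeg m <= mpoly.mdeg b + (vf_deg f).-1)%N ->
  mpoly.mcoeff m (lie f (mpoly.mpolyX R b)) = 0.
Proof.
move=> f0 mb; rewrite lie_coeff// big1// => j _.
have [->|bj] := eqVneq (b j) 0%N; first by rewrite mul0r.
rewrite lie_lin_eq0 ?lie_high_eq0 ?addr0 ?mulr0//.
  by apply: contra mb => /andP[/ltnW -> ->].
by apply: contra mb => /eqP ->; rewrite leqnn leq_addr.
Qed.

Lemma sum_eq_le1 (s : seq (mpoly.multinom n)) (P : pred (mpoly.multinom n)) m : uniq s ->
  \sum_(m' <- s | P m') (m' == m)%:R <= (P m)%:R :> R.
Proof.
move=> us; have [Pm|Pm] := boolP (P m); last first.
  rewrite big1// => m' Pm'; case: eqP => // E; by rewrite -E Pm' in Pm.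
rewrite -natr_sum ler_nat (@leq_trans (\sum_(m' <- s) (m' == m)%N))//.
  by rewrite big_mkcond; apply: leq_sum => m' _; case: ifP.
by rewrite -big_mkcond/= sum1_count count_uniq_mem// leq_b1.
Qed.

(** Each of the mdeg b factors of x^b contributes at most C2: for a given
    factor, distinct monomials of s receive distinct coefficients of f. *)
Lemma lie_coeff_raise f b (s : seq (mpoly.multinom n)) :
  (forall j, mpoly.mcoeff mpoly.mnm0 (f j) = 0) -> uniq s ->
  \sum_(m <- s | (mpoly.mdeg b < mpoly.mdeg m)%N)
    `|mpoly.mcoeff m (lie f (mpoly.mpolyX R b))| <= (mpoly.mdeg b)%:R * C2 f.
Proof.
move=> f0 us.
rewrite (@le_trans _ _ (\sum_(m <- s | (mpoly.mdeg b < mpoly.mdeg m)%N)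
   \sum_j (b j)%:R * `|lie_high f b m j|))//.
  apply: ler_sum => m mb; rewrite lie_coeff// (le_trans (ler_norm_sum _ _ _))//.
  apply: ler_sum => j _; have [->|bj] := eqVneq (b j) 0%N.
    by rewrite !mul0r normr0.
  by rewrite lie_lin_eq0 ?add0r ?normrM ?normr_nat// neq_ltn mb orbT.
rewrite exchange_big /= mdegE_sum mulr_suml; apply: ler_sum => j _.
rewrite -mulr_sumr ler_wpM2l//.
apply: (@le_trans _ _ (\sum_(g : mpoly.bmultinom n (vf_deg f).+1 |
    (2 <= mpoly.mdeg g)%N) `|mpoly.mcoeff g (f j)|)); last exact: le_bigmax.
rewrite (@le_trans _ _ (\sum_(m <- s | (mpoly.mdeg b < mpoly.mdeg m)%N)
  \sum_(g : mpoly.bmultinom n (vf_deg f).+1 | (2 <= mpoly.mdeg g)%N)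
    `|mpoly.mcoeff g (f j)| *
    (m == mpoly.mnm_add (mpoly.mnm_sub b (mpoly.mnm1 j)) g)%:R))//.
  apply: ler_sum => m _; rewrite (le_trans (ler_norm_sum _ _ _))//.
  by apply: ler_sum => g _; rewrite normrM normr_nat.
rewrite exchange_big /=; apply: ler_sum => g _.
rewrite -mulr_sumr ler_piMr// (le_trans (sum_eq_le1 _ _ us))//.
by rewrite lern1 leq_b1.
Qed.

(** The supremum bounds the rows because their range, being finite, is bounded. *)
Lemma le_lognorm_infty k (U : 'M[R]_k) i :
  U i i + \sum_(l | l != i) `|U i l| <= lognorm_infty U.
Proof.
apply: ub_le_sup; last by exists i.
pose F (i : 'I_k) := U i i + \sum_(l | l != i) `|U i l|.
exists (\sum_j `|F j|) => _ [j _ <-]; rewrite -/(F j) (le_trans (ler_norm _))//.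
by rewrite [leRHS](bigD1 j)//= lerDl sumr_ge0.
Qed.

(** The linear part of f acts on x^b as a derivation, so each of the mdeg b
    factors of x^b, say x_j, contributes the row j of the Jacobian; the rows add
    up, and each is bounded by the logarithmic norm. *)
Lemma lie_coeff_lognorm f b (s : seq (mpoly.multinom n)) :
  (forall j, mpoly.mcoeff mpoly.mnm0 (f j) = 0) -> uniq s ->
  mpoly.mcoeff b (lie f (mpoly.mpolyX R b)) +
  \sum_(m <- s | (m != b) && (mpoly.mdeg m == mpoly.mdeg b))
    `|mpoly.mcoeff m (lie f (mpoly.mpolyX R b))|
  <= (mpoly.mdeg b)%:R * lognorm_infty (jacobian0 f).
Proof.
move=> f0 us.
have shiftE j k : b j != 0%N ->
    (b == mpoly.mnm_add (mpoly.mnm_sub b (mpoly.mnm1 j)) (mpoly.mnm1 k)) = (k == j).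
  move=> bj; apply/eqP/eqP => [/mpoly.mnmP/(_ j)|->]; last first.
    apply/mpoly.mnmP => i; rewrite mpoly.mnmDE mpoly.mnmBE mpoly.mnm1E.
    by case: eqP => [<-|_]; rewrite ?subn0 ?addn0// subnK// lt0n.
  rewrite mpoly.mnmDE mpoly.mnmBE !mpoly.mnm1E eqxx.
  by case: eqP => // _ E; exfalso; lia.
have -> : mpoly.mcoeff b (lie f (mpoly.mpolyX R b)) =
    \sum_j (b j)%:R * jacobian0 f j j.
  rewrite lie_coeff//; apply: eq_bigr => j _.
  have [->|bj] := eqVneq (b j) 0%N; first by rewrite !mul0r.
  rewrite lie_high_eq0 ?ltnn// addr0; congr (_ * _).
  rewrite /lie_lin (bigD1 j)//= shiftE// eqxx mulr1 big1 ?addr0// => k /negbTE kj.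
  by rewrite shiftE// kj mulr0.
rewrite mdegE_sum mulr_suml.
rewrite (@le_trans _ _ (\sum_j (b j)%:R * (jacobian0 f j j +
    \sum_(k | k != j) `|jacobian0 f j k|)))//; last first.
  by apply: ler_sum => j _; rewrite ler_wpM2l// le_lognorm_infty.
under [leRHS]eq_bigr do rewrite mulrDr.
rewrite big_split /= lerD2l.
rewrite (@le_trans _ _ (\sum_(m <- s | (m != b) && (mpoly.mdeg m == mpoly.mdeg b))
   \sum_j (b j)%:R * `|lie_lin f b m j|))//.
  apply: ler_sum => m /andP[_ mb]; rewrite lie_coeff// (le_trans (ler_norm_sum _ _ _))//.
  apply: ler_sum => j _; have [->|bj] := eqVneq (b j) 0%N.
    by rewrite !mul0r normr0.
  by rewrite lie_high_eq0 ?addr0 ?normrM ?normr_nat// (eqP mb) ltnn.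
rewrite exchange_big /=; apply: ler_sum => j _; rewrite -mulr_sumr.
have [->|bj] := eqVneq (b j) 0%N; first by rewrite !mul0r.
rewrite ler_wpM2l//.
rewrite (@le_trans _ _ (\sum_(m <- s | (m != b) && (mpoly.mdeg m == mpoly.mdeg b))
  \sum_k `|jacobian0 f j k| *
    (m == mpoly.mnm_add (mpoly.mnm_sub b (mpoly.mnm1 j)) (mpoly.mnm1 k))%:R))//.
  apply: ler_sum => m _; rewrite (le_trans (ler_norm_sum _ _ _))//.
  by apply: ler_sum => k _; rewrite normrM normr_nat.
rewrite exchange_big /= [leRHS]big_mkcond /=; apply: ler_sum => k _.
rewrite -mulr_sumr.
apply: le_trans (ler_wpM2l (normr_ge0 _) (sum_eq_le1 _ _ us)) _.
rewrite [_ == b]eq_sym shiftE//; case: eqP => _ /=; first by rewrite mulr0.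
by rewrite ler_piMr// lern1 leq_b1.
Qed.

End Coefficients.

(** * Rows of the Carleman matrices *)

Section CarlemanRows.
Variables (R : realType) (n : nat) (f : 'I_n -> mpoly.mpoly n R).
Variables (D M N : nat) (alpha : M.-tuple (mpoly.multinom n)).
Variables (psi : N.-tuple (mpoly.multinom n)) (A : 'M[R]_M) (B : 'M[R]_(M, N)).
Hypothesis f0 : forall j, mpoly.mcoeff mpoly.mnm0 (f j) = 0.
Hypothesis alphaP : lists_monomials 1 D alpha.
Hypothesis psiP : lists_monomials D.+1 (D + vf_deg f - 1) psi.
Hypothesis relP : carleman_rel f alpha A psi B.

Let deg i := mpoly.mdeg (tnth alpha i).

Lemma deg_alpha i : (1 <= deg i <= D)%N.
Proof. by case: alphaP => _ <-; exact: mem_tnth. Qed.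

Lemma deg_psi l : (D.+1 <= mpoly.mdeg (tnth psi l) <= D + vf_deg f - 1)%N.
Proof. by case: psiP => _ <-; exact: mem_tnth. Qed.

Lemma carleman_row i :
  lie f (mpoly.mpolyX R (tnth alpha i)) =
  \sum_l A i l *: mpoly.mpolyX R (tnth alpha l)
  + \sum_l B i l *: mpoly.mpolyX R (tnth psi l).
Proof.
have /matrixP/(_ i 0) := relP; rewrite !mxE => ->; congr (_ + _);
  by apply: eq_bigr => l _; rewrite !mxE mpoly.mul_mpolyC.
Qed.

Lemma alpha_neq_psi i l : (tnth alpha i == tnth psi l) = false.
Proof.
apply/eqP => E; have := deg_psi l; have := deg_alpha i; rewrite /deg E; lia.
Qed.

Lemma carleman_A i l :
  A i l = mpoly.mcoeff (tnth alpha l) (lie f (mpoly.mpolyX R (tnth alpha i))).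
Proof.
have /tuple_uniqP inj : uniq alpha by case: alphaP.
rewrite carleman_row mpoly.mcoeffD !raddf_sum /= [X in _ + X]big1 ?addr0 => [|k _].
  rewrite (bigD1 l)//= mpoly.mcoeffZ mpoly.mcoeffX eqxx mulr1 big1 ?addr0// => k kl.
  by rewrite mpoly.mcoeffZ mpoly.mcoeffX (inj_eq inj) (negbTE kl) mulr0.
by rewrite mpoly.mcoeffZ mpoly.mcoeffX eq_sym alpha_neq_psi mulr0.
Qed.

Lemma carleman_B i l :
  B i l = mpoly.mcoeff (tnth psi l) (lie f (mpoly.mpolyX R (tnth alpha i))).
Proof.
have /tuple_uniqP inj : uniq psi by case: psiP.
rewrite carleman_row mpoly.mcoeffD !raddf_sum /= [X in X + _]big1 ?add0r => [|k _].
  rewrite (bigD1 l)//= mpoly.mcoeffZ mpoly.mcoeffX eqxx mulr1 big1 ?addr0// => k kl.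
  by rewrite mpoly.mcoeffZ mpoly.mcoeffX (inj_eq inj) (negbTE kl) mulr0.
by rewrite mpoly.mcoeffZ mpoly.mcoeffX alpha_neq_psi mulr0.
Qed.

Lemma carleman_A_support i l :
  ~~ (deg i <= deg l <= deg i + (vf_deg f).-1)%N -> A i l = 0.
Proof. by move=> h; rewrite carleman_A lie_coeff_support. Qed.

Lemma carleman_B_support i l :
  (deg i + (vf_deg f).-1 < mpoly.mdeg (tnth psi l))%N -> B i l = 0.
Proof.
move=> h; rewrite carleman_B lie_coeff_support//.
by rewrite negb_and -!ltnNge h orbT.
Qed.

Lemma carleman_diag i :
  A i i + \sum_(l | (l != i) && (deg l == deg i)) `|A i l|
  <= (deg i)%:R * lognorm_infty (jacobian0 f).
Proof.
have [ua _] := alphaP; have /tuple_uniqP inj := ua.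
apply: le_trans (lie_coeff_lognorm (tnth alpha i) f0 ua).
rewrite -carleman_A lerD2l big_tuple le_eqVlt; apply/orP; left; apply/eqP.
by apply: eq_big => [l|l _]; [rewrite (inj_eq inj)|rewrite carleman_A].
Qed.

Lemma carleman_raise i :
  \sum_(l | (deg i < deg l)%N) `|A i l| + \sum_l `|B i l| <= (deg i)%:R * C2 f.
Proof.
have us : uniq (alpha ++ psi).
  rewrite cat_uniq; case: alphaP => -> Ha; case: psiP => -> Hp; rewrite andbT /=.
  by apply/hasPn => m; rewrite /= Ha Hp; lia.
apply: le_trans (lie_coeff_raise (tnth alpha i) f0 us).
rewrite big_cat !big_tuple /=; apply: lerD.
  by apply: ler_sum => l _; rewrite carleman_A.
rewrite [leRHS](eq_bigl xpredT) => [|l].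
  by apply: ler_sum => l _; rewrite carleman_B.
by rewrite (leq_ltn_trans (proj2 (andP (deg_alpha i))))//; case/andP: (deg_psi l).
Qed.

End CarlemanRows.

(** * Polynomials along a trajectory *)

Section ChainRule.
Variables (R : realType) (n : nat) (f : 'I_n -> mpoly.mpoly n R).
Implicit Types (p q : mpoly.mpoly n R).

Lemma lieM p q : lie f (p * q) = lie f p * q + p * lie f q.
Proof.
rewrite /lie mulr_sumr mulr_suml -big_split; apply: eq_bigr => j _ /=.
by rewrite mpoly.mderivM; ring.
Qed.

(** Both derivatives obey the Leibniz rule in q, so that constants and coordinates
    suffice. *)
Lemma is_derive_mpeval (x : R -> 'cV[R]_n) (s : R) q :
  is_derive s 1 x (vf f (x s)) ->
  is_derive s (1 : R) (fun u => mpeval (x u) q) (mpeval (x s) (lie f q)).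
Proof.
move=> xP.
have xiP i : is_derive s (1 : R) (fun u => x u i 0) (mpeval (x s) (f i)).
  have [dx vx] := xP; split; first by move/derivable_mxP: dx; apply.
  by move: vx; rewrite derive_mx// => /matrixP/(_ i 0); rewrite !mxE.
pose ok p := is_derive s (1 : R) (fun u => mpeval (x u) p) (mpeval (x s) (lie f p)).
have okC c : ok (mpoly.mpolyC n c).
  rewrite /ok /lie big1 => [|j _]; last by rewrite mpoly.mderivC mul0r.
  rewrite /mpeval mpoly.meval0 (_ : (fun _ => _) = cst c); first exact: is_derive_cst.
  by apply/funext => u; rewrite mpoly.mevalC.
have okX i : ok (mpoly.mpolyX R (mpoly.mnm1 i)).
  rewrite /ok /lie (bigD1 i)//= big1 => [|j ji]; rewrite mpoly.mderivX mpoly.mnm1E.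
    rewrite eqxx scale1r addr0.
    have -> : mpoly.mnm_sub (mpoly.mnm1 i) (mpoly.mnm1 i) = mpoly.mnm0.
      by apply/mpoly.mnmP => l; rewrite mpoly.mnmBE mpoly.mnm0E subnn.
    rewrite mpoly.mpolyX0 mul1r (_ : (fun u => _) = fun u => x u i 0)//.
    by apply/funext => u; rewrite /mpeval mpoly.mevalXU.
  by rewrite eq_sym (negbTE ji) scale0r mul0r.
have okM p1 p2 : ok p1 -> ok p2 -> ok (p1 * p2).
  rewrite /ok /mpeval => h1 h2; rewrite lieM mpoly.mevalD !mpoly.mevalM.
  rewrite (_ : (fun u => _) = (fun u => mpeval (x u) p1) * (fun u => mpeval (x u) p2)).
    apply: is_derive_eq (is_deriveM h1 h2) _.
    by rewrite /GRing.scale /= addrC [X in X + _]mulrC.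
  by apply/funext => u; rewrite /mpeval mpoly.mevalM.
have okD p1 p2 : ok p1 -> ok p2 -> ok (p1 + p2).
  rewrite /ok /mpeval => h1 h2; rewrite (_ : lie f _ = lie f p1 + lie f p2).
    rewrite mpoly.mevalD; rewrite (_ : (fun u => _) =
      (fun u => mpeval (x u) p1) + (fun u => mpeval (x u) p2)).
      exact: is_deriveD.
    by apply/funext => u; rewrite /mpeval mpoly.mevalD.
  by rewrite /lie -big_split; apply: eq_bigr => j _; rewrite /= mpoly.mderivD mulrDl.
have ok1 : ok 1 by exact: (okC 1).
rewrite -/(ok q); elim/mpoly.mpolyind: q => [|c m p _ _ IH].
  by rewrite -mpoly.mpolyC0; exact: okC.
apply: (okD) => //; rewrite -mpoly.mul_mpolyC; apply: (okM) => //.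
rewrite mpoly.mpolyXE_id; apply: (big_ind ok ok1 okM) => i _.
move: (m i) => e; elim: e => [|e IHe]; first by rewrite expr0.
by rewrite exprS; exact: okM.
Qed.

End ChainRule.

(** * Closed form of Theta *)

Section Theta.
Variable R : realType.

(** Unlike [Theta], which vanishes at negative times, this primitive has the
    derivative exp(a s) at every s, in particular a two-sided one at 0. *)
Definition exp_primitive (a s : R) : R :=
  if a == 0 then s else (expR (a * s) - 1) / a.

Lemma exp_primitive0 a : exp_primitive a 0 = 0.
Proof. by rewrite /exp_primitive mulr0 expR0 subrr mul0r; case: ifP. Qed.

Lemma is_derive_exp_primitive (a s : R) :
  is_derive s (1 : R) (exp_primitive a) (expR (a * s)).
Proof.
rewrite /exp_primitive; have [->|a0] := eqVneq a 0.
  by rewrite mul0r expR0; exact: is_derive_id.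
rewrite (_ : (fun s => _) = a^-1 \*: ((fun s => expR (a * s)) - cst 1)).
  have hB := is_deriveB (is_derive_expR_lin a s) (is_derive_cst (1 : R) s 1).
  apply: is_derive_eq (is_deriveZ a^-1 hB) _.
  by rewrite subr0 /GRing.scale /= mulKf.
by apply/funext => u; rewrite /= !fctE /GRing.scale /= mulrC.
Qed.

Lemma exp_primitive_ge0 (a s : R) : 0 <= s -> 0 <= exp_primitive a s.
Proof.
move=> s0; rewrite -(exp_primitive0 a).
apply: ge0_is_derive_le s0 (fun u _ => is_derive_exp_primitive a u) _ => u _.
exact: expR_ge0.
Qed.

Lemma ThetaE (mu : R) h t : 0 <= t ->
  Theta mu h t = exp_primitive (Num.min mu 0 + h%:R * Num.max mu 0) t.
Proof.
rewrite le_eqVlt => /predU1P[<-|t0]; rewrite /Theta; set a := _ + _.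
  by rewrite set_itv1 Rintegral_set1 exp_primitive0.
have dcont (g dg : R -> R) : (forall s, is_derive s (1 : R) g (dg s)) -> continuous g.
  move=> gP s; apply: differentiable_continuous; apply/derivable1_diffP.
  exact: (@ex_derive _ _ _ _ _ _ _ (gP s)).
rewrite /Rintegral (@continuous_FTC2 _ _ (exp_primitive a))//=.
- by rewrite exp_primitive0 subr0.
- apply: continuous_subspaceT; exact: dcont (is_derive_expR_lin a).
- have ce := dcont _ _ (is_derive_exp_primitive a).
  split => [s _||].
  + exact: (@ex_derive _ _ _ _ _ _ _ (is_derive_exp_primitive a s)).
  + exact: cvg_at_right_filter (ce 0).
  + exact: cvg_at_left_filter (ce t).
- move=> s _; rewrite derive1E.
  exact: (@derive_val _ _ _ _ _ _ _ (is_derive_exp_primitive a s)).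
Qed.

End Theta.

(** * The supersolution *)

Lemma ler_horner (R : realDomainType) (p q : {poly R}) x : 0 <= x ->
  (forall j, p`_j <= q`_j) -> p.[x] <= q.[x].
Proof.
move=> x0 pq; rewrite (horner_coef_wide _ (leq_maxl (size p) (size q))).
rewrite (horner_coef_wide _ (leq_maxr (size p) (size q))).
by apply: ler_sum => j _; rewrite ler_wpM2r ?exprn_ge0.
Qed.

Lemma horner_ge0 (R : realDomainType) (p : {poly R}) x :
  0 <= x -> (forall j, 0 <= p`_j) -> 0 <= p.[x].
Proof. by move=> x0 p0; rewrite -(horner0 x) ler_horner// => j; rewrite coef0. Qed.

Section Majorant.
Variables (R : realType) (h D : nat) (C mu : R).

Definition rising (k j : nat) : nat := \prod_(0 <= r < j) (k + r * h).

Lemma risingS k j : rising k j.+1 = (k * rising (k + h) j)%N.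
Proof.
rewrite /rising big_nat_recl// mul0n addn0; congr (_ * _)%N.
by apply: eq_bigr => r _; rewrite mulSn addnA.
Qed.

Lemma leq_rising k l j : (k <= l)%N -> (rising k j <= rising l j)%N.
Proof. by move=> kl; apply: leq_prod => r _; rewrite leq_add2r. Qed.

(** The condition under which j jumps, of heights between 1 and h, can lead from
    degree k to a degree at most D from which one more jump exceeds D. *)
Definition escapes (k j : nat) : bool := (D < k + j * h + h)%N && (j + k <= D)%N.

Definition weight (k j : nat) : R := (rising k j)%:R * C ^+ j / j`!%:R.

Definition jump_poly (k : nat) : {poly R} :=
  \poly_(j < D) (if escapes k j then weight k j else 0).

(** A common bound for the polynomials of the degrees that one jump from degree k
    can reach ([jump_poly_le]); it counts the jumps that remain. *)
Definition next_jump_poly (k : nat) : {poly R} :=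
  \poly_(j < D) (if escapes k j.+1 then weight (k + h) j else 0).

(** Differentiating in Theta removes the first jump, and its cost k C. *)
Lemma deriv_jump_poly k : (0 < k)%N ->
  (jump_poly k)^`() = (k%:R * C) *: next_jump_poly k.
Proof.
move=> k0; apply/polyP => j; rewrite coef_deriv coefZ !coef_poly.
have [e|] := boolP (escapes k j.+1); last first.
  by rewrite !if_same mulr0 mul0rn.
have /andP[_ jD] := e.
have -> : (j.+1 < D)%N by lia.
have -> : (j < D)%N by lia.
rewrite /weight risingS factS exprS !natrM -[LHS]mulr_natr.
have : (j.+1%:R : R) != 0 by rewrite pnatr_eq0.
have : (j`!%:R : R) != 0 by rewrite pnatr_eq0 -lt0n fact_gt0.
move: (j.+1%:R : R) (j`!%:R : R) (k%:R : R) ((rising _ _)%:R : R) (C ^+ j) => u w x y z w0 u0.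
by field; rewrite u0 w0.
Qed.

Let a := Num.min mu 0 + h%:R * Num.max mu 0.

Definition jump_bound (k : nat) (s : R) : R :=
  expR (k%:R * mu * s) * (jump_poly k).[exp_primitive a s].

(** The bound for all [jump_bound l] with k < l <= k + h that enters the
    derivative of [jump_bound k]. *)
Definition jump_rate (k : nat) (s : R) : R :=
  expR ((k%:R * mu + a) * s) * (next_jump_poly k).[exp_primitive a s].

Lemma is_derive_horner_exp_primitive (p : {poly R}) s :
  is_derive s (1 : R) (fun u => p.[exp_primitive a u])
    (p^`().[exp_primitive a s] * expR (a * s)).
Proof.
exact: (@is_derive_chain _ (horner p) (exp_primitive a) s _ _
  (is_derive_poly _ _) (is_derive_exp_primitive a s)).
Qed.

Lemma is_derive_jump_bound k s : (0 < k)%N ->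
  is_derive s (1 : R) (jump_bound k)
    (k%:R * mu * jump_bound k s + k%:R * C * jump_rate k s).
Proof.
move=> k0; apply: is_derive_eq (is_deriveM (is_derive_expR_lin (k%:R * mu) s)
  (is_derive_horner_exp_primitive (jump_poly k) s)) _.
rewrite deriv_jump_poly// hornerZ /GRing.scale /= /jump_rate [(_ + a) * s]mulrDl expRD /jump_bound.
ring.
Qed.

Lemma jump_bound0 k : (0 < k <= D)%N -> (D < k + h)%N -> jump_bound k 0 = 1.
Proof.
move=> /andP[k0 kD] Dk; rewrite /jump_bound mulr0 expR0 mul1r exp_primitive0.
rewrite horner_coef0 coef_poly (leq_trans k0 kD) /escapes mul0n addn0 Dk add0n kD.
by rewrite /weight /rising big_geq// expr0 mul1r fact0 divr1.
Qed.

(** The primitive of jump_poly 1 vanishing at 0; at the value Theta(t) it is the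
    sum in the final bound. *)
Definition error_poly : {poly R} :=
  \poly_(i < D.+1) (if i is j.+1 then (jump_poly 1)`_j / j.+1%:R else 0).

Lemma deriv_error_poly : error_poly^`() = jump_poly 1.
Proof.
apply/polyP => j; rewrite coef_deriv coef_poly ltnS.
case: (ltnP j D) => jD; last by rewrite mul0rn coef_poly ltnNge jD.
by rewrite -[LHS]mulr_natr divfK// pnatr_eq0.
Qed.

Hypotheses (h_gt0 : (0 < h)%N) (C_ge0 : 0 <= C).

Lemma weight_ge0 k j : 0 <= weight k j.
Proof. by rewrite /weight mulr_ge0 ?invr_ge0 ?ler0n// mulr_ge0 ?ler0n ?exprn_ge0. Qed.

Lemma jump_poly_ge0 k x : 0 <= x -> 0 <= (jump_poly k).[x].
Proof.
move=> x0; apply: horner_ge0 => // j; rewrite coef_poly.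
by case: ifP => // _; case: ifP => // _; rewrite weight_ge0.
Qed.

Lemma next_jump_poly_ge0 k x : 0 <= x -> 0 <= (next_jump_poly k).[x].
Proof.
move=> x0; apply: horner_ge0 => // j; rewrite coef_poly.
by case: ifP => // _; case: ifP => // _; rewrite weight_ge0.
Qed.

Lemma jump_poly_le k l x : 0 <= x -> (k < l <= k + h)%N ->
  (jump_poly l).[x] <= (next_jump_poly k).[x].
Proof.
move=> x0 /andP[kl lkh]; apply: ler_horner => // j; rewrite !coef_poly.
case: ifP => // _; case: ifP => [/andP[e1 e2]|_]; last first.
  by case: ifP => // _; exact: weight_ge0.
have -> : escapes k j.+1 by apply/andP; split; lia.
rewrite /weight ler_wpM2r ?invr_ge0 ?ler0n// ler_wpM2r ?exprn_ge0//.
by rewrite ler_nat leq_rising.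
Qed.

(** The exponent of Theta' pays for the change of growth rate in one jump: the
    worst case is d = h if mu >= 0, and d = 1 if mu < 0. *)
Lemma rate_le (d : nat) : (0 < d <= h)%N -> d%:R * mu <= a.
Proof.
move=> /andP[d0 dh]; rewrite /a.
have d1 : (1 : R) <= d%:R by rewrite ler1n.
have dhR : d%:R <= h%:R :> R by rewrite ler_nat.
by have [m0|m0] := leP mu 0; nra.
Qed.

Lemma jump_bound_ge0 k s : 0 <= s -> 0 <= jump_bound k s.
Proof.
by move=> s0; rewrite mulr_ge0 ?expR_ge0// jump_poly_ge0// exp_primitive_ge0.
Qed.

Lemma jump_bound_le k l s : 0 <= s -> (k < l <= k + h)%N ->
  jump_bound l s <= jump_rate k s.
Proof.
move=> s0 kl; apply: ler_pM; rewrite ?expR_ge0 ?jump_poly_ge0 ?exp_primitive_ge0//.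
  rewrite ler_expR ler_wpM2r// -lerBlDl -mulrBl -natrB; last first.
    by case/andP: kl => /ltnW.
  by rewrite rate_le//; lia.
by rewrite jump_poly_le// exp_primitive_ge0.
Qed.

Lemma jump_bound1_le s : 0 <= s ->
  jump_bound 1 s <= error_poly^`().[exp_primitive a s] * expR (a * s).
Proof.
move=> s0; rewrite /jump_bound deriv_error_poly [leRHS]mulrC ler_wpM2r//.
  by rewrite jump_poly_ge0// exp_primitive_ge0.
by rewrite ler_expR ler_wpM2r// rate_le.
Qed.

Lemma leq_support_gap j : (0 < D)%N -> (support_gap D h <= j)%N = (D <= j * h + h)%N.
Proof.
move=> D0; rewrite /support_gap.
have hq : (0 : rat) < h%:R by rewrite ltr0n.
set q : rat := _ / _.
have c0 : 0 <= Num.ceil q.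
  rewrite ceil_ge0 /q ltr_pdivlMr// mulN1r -subr_gt0 opprK subrK ltr0n//.
rewrite -lez_nat gez0_abs// ceil_le_int /q ler_pdivrMr//.
by rewrite lerBlDr -pmulrn -natrM -natrD ler_nat.
Qed.

Lemma horner_error_poly x : (0 < D)%N ->
  error_poly.[x] = \sum_(support_gap D h <= j < D)
    (Pprod h j)%:R * C ^+ j * (x ^+ j.+1 / j.+1`!%:R).
Proof.
move=> D0; rewrite horner_poly big_ord_recl mul0r add0r.
rewrite big_geq_mkord [RHS]big_mkcond /=; apply: eq_bigr => j _.
rewrite /bump /= add1n coef_poly ltn_ord /escapes leq_support_gap//.
rewrite addn1 ltn_ord andbT [(1 + _)%N]add1n addSn ltnS.
case: ifP => _; last by rewrite !mul0r.
rewrite /weight factS natrM invfM.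
have -> : rising 1 j = Pprod h j by [].
by ring.
Qed.

End Majorant.

(** * The truncation error *)

Section Bounds.
Variables (R : realType) (n : nat).
Implicit Types (f : 'I_n -> mpoly.mpoly n R).

Lemma C2_ge0 f : 0 <= C2 f.
Proof. by rewrite /C2; exact: bigmax_ge_id. Qed.

Lemma mpeval_monomial_le (y : 'cV[R]_n) (r : R) (m : mpoly.multinom n) :
  (forall i, `|y i 0| <= r) ->
  `|mpeval y (mpoly.mpolyX R m)| <= r ^+ mpoly.mdeg m.
Proof.
move=> yr; rewrite /mpeval mpoly.mevalX normr_prod mpoly.mdegE -prodrXr.
apply: ler_prod => i _; rewrite normr_ge0 normrX lerXn2r ?nnegrE//.
exact: le_trans (normr_ge0 _) (yr i).
Qed.

Lemma expr_window_le (r : R) (D h d : nat) : 0 <= r -> (D < d <= D + h)%N ->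
  r ^+ d <= r ^+ D.+1 * Num.max r 1 ^+ h.-1.
Proof.
move=> r0 /andP[Dd dDh]; rewrite -(subnKC Dd) exprD ler_wpM2l ?exprn_ge0//.
have m1 : 1 <= Num.max r 1 by rewrite le_max lexx orbT.
have m0 : 0 <= Num.max r 1 by rewrite (le_trans _ m1).
apply: (@le_trans _ _ (Num.max r 1 ^+ (d - D.+1))).
  by rewrite lerXn2r ?nnegrE// le_max lexx.
by apply: ler_weXn2l => //; lia.
Qed.

Lemma entry_le_norm (y : 'cV[R]_n) i : `|y i 0| <= `|y|.
Proof.
by rewrite [leRHS]/Num.Def.normr/= mx_normrE; exact: (le_bigmax _ _ (i, 0)).
Qed.

End Bounds.

Theorem theorem2 (R : realType) (n : nat) (f : 'I_n -> mpoly.mpoly n R)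
    (x0 : 'cV[R]_n) (T r : R) (J : set R) (x : R -> 'cV[R]_n) :
  let p := vf_deg f in
  let h := p.-1 in
  let mu1 := lognorm_infty (jacobian0 f) in
  (2 <= p)%N ->
  vf f 0 = 0 ->
  0 < T ->
  is_solution f x0 J x ->
  `[0, T] `<=` J ->
  (* the norm of 'cV[R]_n is the max norm *)
  (ereal_sup [set `|x t|%:E | t in `[0%R, T]] <= r%:E)%E ->
  forall D : nat, (1 <= D)%N ->
  forall (M : nat) (alpha : M.-tuple (mpoly.multinom n))
         (N : nat) (psi : N.-tuple (mpoly.multinom n))
         (A : 'M[R]_M) (B : 'M[R]_(M, N)) (v : 'cV[R]_M),
  lists_monomials 1 D alpha ->
  by_degree alpha ->
  lists_monomials D.+1 (D + p - 1) psi ->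
  carleman_rel f alpha A psi B ->
  deg1_supported alpha v ->
  forall t : R, 0 <= t <= T ->
  carleman_error alpha A v x x0 t <=
    l1norm v * D%:R * C2 f * r ^+ D.+1 * Num.max r 1 ^+ h.-1 *
    \sum_(support_gap D h <= j < D)
      (Pprod h j)%:R * C2 f ^+ j * (Theta mu1 h t ^+ j.+1 / j.+1`!%:R).
Proof.
move=> p h mu1 p2 vf0 T0 [_ _ _ x00 xsol] TJ xr D D1 M alpha N psi A B v.
move=> alphaP _ psiP relP vP t /andP[t0 tT].
have h0 : (0 < h)%N by rewrite /h; lia.
have f0 j : mpoly.mcoeff mpoly.mnm0 (f j) = 0.
  by move/matrixP: vf0 => /(_ j 0); rewrite !mxE mpeval0.
have st s : 0 <= s <= t -> s \in `[0, T]%R.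
  by move=> /andP[s0 st]; rewrite in_itv /= s0 (le_trans st).
have xnorm s : 0 <= s <= t -> `|x s| <= r.
  move=> /st sT; rewrite -lee_fin; apply: le_trans xr.
  by apply: ereal_sup_ubound; exists s.
have r0 : 0 <= r by apply: le_trans (xnorm 0 _); rewrite ?normr_ge0// lexx.
set C := C2 f; have C0 : 0 <= C := C2_ge0 f.
pose Rm := r ^+ D.+1 * Num.max r 1 ^+ h.-1.
have Rm0 : 0 <= Rm by rewrite mulr_ge0 ?exprn_ge0// le_max r0.
pose K := D%:R * C * Rm.
have K0 : 0 <= K by rewrite mulr_ge0// mulr_ge0.
pose a := Num.min mu1 0 + h%:R * Num.max mu1 0.
pose deg i := mpoly.mdeg (tnth alpha i).
have degP i : (0 < deg i <= D)%N by exact: deg_alpha alphaP i.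
pose z0 : 'cV[R]_M := monomial_val alpha x0.
(* E is the error vector, F its source, G the constant bound for F *)
pose E i s := mpeval (x s) (mpoly.mpolyX R (tnth alpha i)) - (mxexp (s *: A) *m z0) i 0.
pose F i s := \sum_l B i l * mpeval (x s) (mpoly.mpolyX R (tnth psi l)).
have dE i s : 0 <= s <= t -> is_derive s (1 : R) (E i) (\sum_m A i m * E m s + F i s).
  move=> /st/TJ/xsol xs.
  have h1 := is_derive_mpeval (mpoly.mpolyX R (tnth alpha i)) xs.
  have h2 : is_derive s (1 : R) (fun u => (mxexp (u *: A) *m z0) i 0)
      (\sum_m A i m * (mxexp (s *: A) *m z0) m 0).
    rewrite (_ : (fun u => _) = fun u => \sum_l mxexp (u *: A) i l * z0 l 0); last first.
      by apply/funext => u; rewrite mxE.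
    apply: is_derive_eq (@is_derive_dot _ _ _ (fun l => cst (z0 l 0))
      (fun l u => (mxexp (u *: A) *m A) i l) (fun _ => cst 0) s
      (fun l => is_derive_mxexp _ _ _ _) (fun l => is_derive_cst _ _ _)) _.
    transitivity ((mxexp (s *: A) *m A *m z0) i 0).
      by rewrite mxE; apply: eq_bigr => l _; rewrite mulr0 add0r.
    by rewrite mxexp_comm -mulmxA mxE.
  apply: is_derive_eq (is_deriveB h1 h2) _.
  rewrite (carleman_row relP) /mpeval mpoly.mevalD !raddf_sum /=.
  rewrite addrAC; congr (_ + _); last first.
    by apply: eq_bigr => l _; rewrite mpoly.mevalZ.
  by rewrite -big_split; apply: eq_bigr => l _; rewrite /= mpoly.mevalZ -mulrBr.
have E0 i : E i 0 = 0 by rewrite /E mxexp0 mul1mx !mxE x00 subrr.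
pose G i := if (D < deg i + h)%N then K else 0.
have FG i s : 0 <= s <= t -> `|F i s| <= G i.
  move=> sP; rewrite /F (le_trans (ler_norm_sum _ _ _))//.
  rewrite /G; case: ltnP => Dh; last first.
    rewrite big1// => l _; rewrite (carleman_B_support f0 alphaP psiP relP) ?mul0r ?normr0//.
    by rewrite (leq_ltn_trans Dh)//; case/andP: (deg_psi psiP l).
  rewrite (@le_trans _ _ (\sum_l `|B i l| * Rm))//.
    apply: ler_sum => l _; rewrite normrM ler_wpM2l//.
    apply: le_trans (mpeval_monomial_le _ (fun k => le_trans (entry_le_norm _ k) (xnorm s sP))) _.
    apply: expr_window_le => //; have := deg_psi psiP l; rewrite /h; lia.
  rewrite -mulr_suml /K ler_wpM2r//.
  rewrite (@le_trans _ _ ((deg i)%:R * C))//.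
    apply: le_trans (carleman_raise f0 alphaP psiP relP i).
    by rewrite lerDr sumr_ge0.
  by rewrite ler_wpM2r// ler_nat; case/andP: (degP i).
pose rho i s := K * jump_bound h D C mu1 (deg i) s.
pose drho i s := K * ((deg i)%:R * mu1 * jump_bound h D C mu1 (deg i) s
   + (deg i)%:R * C * jump_rate h D C mu1 (deg i) s).
have drhoP i s : 0 <= s <= t -> is_derive s (1 : R) (rho i) (drho i s).
  move=> _; have i0 : (0 < deg i)%N by case/andP: (degP i).
  exact: is_derive_scale (is_derive_jump_bound h D C mu1 s i0).
have Grho i : G i <= rho i 0.
  rewrite /G /rho; case: ifP => Dh; first by rewrite jump_bound0 ?mulr1.
  by rewrite mulr_ge0// jump_bound_ge0.
(* entries of A that preserve the degree are paid for by the growth of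
   exp(k mu1 s), entries that raise it by the derivative of the polynomial *)
have super i s : 0 <= s <= t ->
    A i i * rho i s + \sum_(m | m != i) `|A i m| * rho m s <= drho i s.
  move=> /andP[s0 _].
  have q0 k : 0 <= jump_bound h D C mu1 k s by exact: jump_bound_ge0.
  rewrite (bigID (fun m => deg m == deg i)) /= addrA /drho mulrDr; apply: lerD.
    rewrite (eq_bigr (fun m => `|A i m| * rho i s)) => [|m /andP[_ /eqP E1]]; last first.
      by rewrite /rho E1.
    rewrite -mulr_suml -mulrDl /rho mulrCA ler_wpM2l// ler_wpM2r//.
    exact: (carleman_diag f0 alphaP psiP relP).
  apply: (@le_trans _ _ (\sum_(m | (deg i < deg m)%N)
      `|A i m| * (K * jump_rate h D C mu1 (deg i) s))).
    rewrite big_mkcond [leRHS]big_mkcond /=; apply: ler_sum => m _.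
    have [im|mi] := ltnP (deg i) (deg m).
      case: ifP => _; last first.
        rewrite mulr_ge0// mulr_ge0// mulr_ge0 ?expR_ge0//.
        by rewrite next_jump_poly_ge0// exp_primitive_ge0.
      have [mh|mh] := leqP (deg m) (deg i + h).
        by rewrite ler_wpM2l// ler_wpM2l// jump_bound_le// im mh.
      rewrite (carleman_A_support f0 alphaP psiP relP) ?normr0 ?mul0r//.
      by rewrite negb_and -!ltnNge mh orbT.
    case: ifP => // /andP[_ mi2].
    rewrite (carleman_A_support f0 alphaP psiP relP) ?normr0 ?mul0r//.
    by rewrite negb_and -!ltnNge ltn_neqAle mi2 mi.
  rewrite -mulr_suml mulrCA ler_wpM2l// ler_wpM2r//.
    by rewrite mulr_ge0 ?expR_ge0// next_jump_poly_ge0// exp_primitive_ge0.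
  apply: le_trans (carleman_raise f0 alphaP psiP relP i).
  by rewrite lerDl sumr_ge0.
pose H s := K * (error_poly h D C).[exp_primitive a s].
pose dH s := K * ((error_poly h D C)^`().[exp_primitive a s] * expR (a * s)).
have dHP s : 0 <= s <= t -> is_derive s (1 : R) H (dH s).
  by move=> _; exact: is_derive_scale (is_derive_horner_exp_primitive _ _ _ _).
have H0 : H 0 = 0.
  by rewrite /H exp_primitive0 horner_coef0 coef_poly mulr0.
have Ej j : deg j = 1%N -> `|E j t| <= H t.
  move=> j1; rewrite -(subr0 (H t)) -[X in _ - X]H0.
  apply: (linear_comparison t0 dE E0 FG drhoP Grho super dHP) => s /andP[s0 _].
  by rewrite /rho j1 ler_wpM2l// jump_bound1_le.
have -> : carleman_error alpha A v x x0 t = `|\sum_j v j 0 * E j t|.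
  rewrite /carleman_error !mxE -sumrB; congr `|_|; apply: eq_bigr => j _.
  by rewrite !mxE -mulrBr /E mxE.
have -> : l1norm v * D%:R * C * r ^+ D.+1 * Num.max r 1 ^+ h.-1 *
    \sum_(support_gap D h <= j < D)
      (Pprod h j)%:R * C ^+ j * (Theta mu1 h t ^+ j.+1 / j.+1`!%:R) =
    l1norm v * H t.
  by rewrite /H horner_error_poly// ThetaE// /K /Rm !mulrA.
rewrite /l1norm mulr_suml (le_trans (ler_norm_sum _ _ _))//.
apply: ler_sum => j _; rewrite normrM.
have [->|vj] := eqVneq (v j 0) 0; first by rewrite normr0 !mul0r.
by rewrite ler_wpM2l//; apply/Ej/vP.
Qed.
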